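(* Let $n\ge2$, let $G$ be the binary dihedral group $\mathbf{D}_n\subset\mathrm{SU}_2$, and let $V=\mathbb{C}^2$. Then the Poincaré series $m^0(t)=\sum_{k\ge0}\dim\bigl((V^{\otimes k})^G\bigr)t^k$ for the $G$-invariants in $T(V)=\bigoplus_{k\ge0}V^{\otimes k}$ is given by $$ m^0(t)=\frac{2t^{n+1}\,\mathrm{T}_{n+1}\left(\frac{t^{-1}}{2}\right)}{(1-4t^2)\prod_{r=1}^{n-1}\left(1-2\cos\left(\frac{\pi r}{n}\right)t\right)}=\frac{\prod_{r=1}^{n+1}\left(1-2\cos\left(\frac{(2r-1)\pi}{2(n+1)}\right)t\right)}{(1-4t^2)\prod_{r=1}^{n-1}\left(1-2\cos\left(\frac{\pi r}{n}\right)t\right)} $$ $$ =\frac{2^{-n}\sum_{r=0}^{\lfloor (n+1)/2\rfloor}\binom{n+1}{2r}(1-4t^2)^r}{(1-4t^2)\sum_{r=0}^{\lfloor (n-1)/2\rfloor}(-1)^r\binom{n-1-r}{r}t^{2r}}, $$ where $\mathrm{T}_{n+1}$ is the Chebyshev polynomial of the first kind of degree $n+1$.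
   Context: $\mathbf{D}_n$ is the subgroup of order $4n$ of $\mathrm{SU}_2$ (the $2\times2$ complex special unitary matrices) generated by $x=\begin{pmatrix}\zeta_{2n}^{-1}&0\\0&\zeta_{2n}\end{pmatrix}$ and $y=\begin{pmatrix}0&i\\i&0\end{pmatrix}$, where $i=\sqrt{-1}$ and $\zeta_{2n}=e^{\pi i/n}$. It acts on the space $V=\mathbb{C}^2$ of column vectors by matrix multiplication. $V^{\otimes0}=\mathbb{C}$ is the trivial module. The Chebyshev polynomials of the first kind are defined by $\mathrm{T}_0(t)=1$, $\mathrm{T}_1(t)=t$, $\mathrm{T}_{k+1}(t)=2t\,\mathrm{T}_k(t)-\mathrm{T}_{k-1}(t)$ for $k\ge1$; the expression $2t^{n+1}\mathrm{T}_{n+1}(t^{-1}/2)$ is a polynomial in $t$. The identities hold for formal power series in $t$. *)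

(* Defs.v *)
From HB Require Import structures.
From mathcomp Require Import all_boot all_order all_algebra.
From mathcomp Require Import all_classical all_reals all_analysis.
From mathcomp Require Import complex mxtens.

Set Implicit Arguments.
Unset Strict Implicit.
Unset Printing Implicit Defensive.

Import Order.TTheory GRing.Theory Num.Theory.

Local Open Scope ring_scope.
Local Open Scope classical_set_scope.

(** * Formal power series in one variable over a field, as a commutative ring
    in which the series with nonzero constant term are the units. *)

Record fps (F : Type) := Fps { coefs : nat -> F }.

Section FpsRing.
Variable F : fieldType.
Implicit Types f g h : fps F.

HB.instance Definition _ := gen_eqMixin (fps F).
HB.instance Definition _ := gen_choiceMixin (fps F).

Lemma fpsP f g : (forall n, coefs f n = coefs g n) -> f = g.
Proof. by case: f g => [f] [g] /= /funext ->. Qed.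

Definition fps_zero := Fps (fun _ => 0 : F).
Definition fps_opp f := Fps (fun n => - coefs f n).
Definition fps_add f g := Fps (fun n => coefs f n + coefs g n).
Definition fps_mul f g :=
  Fps (fun n => \sum_(i < n.+1) coefs f i * coefs g (n - i)%N).

Definition fps_of_poly (p : {poly F}) : fps F := Fps (fun n => p`_n).

Lemma fps_addA : associative fps_add.
Proof. by move=> f g h; apply: fpsP => n /=; rewrite addrA. Qed.
Lemma fps_addC : commutative fps_add.
Proof. by move=> f g; apply: fpsP => n /=; rewrite addrC. Qed.
Lemma fps_add0 : left_id fps_zero fps_add.
Proof. by move=> f; apply: fpsP => n /=; rewrite add0r. Qed.
Lemma fps_addN : left_inverse fps_zero fps_opp fps_add.
Proof. by move=> f; apply: fpsP => n /=; rewrite addNr. Qed.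

HB.instance Definition _ :=
  GRing.isZmodule.Build (fps F) fps_addA fps_addC fps_add0 fps_addN.

Definition fps_trunc n f : {poly F} := \poly_(i < n.+1) coefs f i.

Lemma coef_fps_trunc m n f : (n <= m)%N -> (fps_trunc m f)`_n = coefs f n.
Proof. by move=> nm; rewrite coef_poly ltnS nm. Qed.

Lemma fps_mulE m n f g : (n <= m)%N ->
  coefs (fps_mul f g) n = (fps_trunc m f * fps_trunc m g)`_n.
Proof.
move=> nm; rewrite coefM /=; apply: eq_bigr => i _.
have im : (i <= m)%N by rewrite (leq_trans _ nm) // -ltnS.
by rewrite !coef_fps_trunc // (leq_trans (leq_subr _ _) nm).
Qed.

Lemma fps_mulC : commutative fps_mul.
Proof. by move=> f g; apply: fpsP => n; rewrite !(fps_mulE _ _ (leqnn n)) mulrC. Qed.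

Lemma fps_mulA : associative fps_mul.
Proof.
move=> f g h; apply: fpsP => n; rewrite !(fps_mulE _ _ (leqnn n)).
transitivity ((fps_trunc n f * fps_trunc n g * fps_trunc n h)`_n).
  rewrite -mulrA !coefM; apply: eq_bigr => i _; congr (_ * _).
  by rewrite coef_fps_trunc ?leq_subr // (fps_mulE _ _ (leq_subr _ _)).
rewrite [LHS]coefM [RHS]coefM; apply: eq_bigr => i _; congr (_ * _).
have lin : (i <= n)%N by rewrite -ltnS.
by rewrite coef_fps_trunc // (fps_mulE _ _ lin).
Qed.

Lemma fps_mul1 : left_id (fps_of_poly 1) fps_mul.
Proof.
move=> f; apply: fpsP => n /=.
rewrite big_ord_recl /= coef1 mul1r subn0 big1 ?addr0 // => i _.
by rewrite coef1 mul0r.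
Qed.

Lemma fps_mulDl : left_distributive fps_mul fps_add.
Proof.
move=> f g h; apply: fpsP => n /=; rewrite -big_split /=.
by apply: eq_bigr => i _; rewrite mulrDl.
Qed.

Lemma fps_1_neq0 : fps_of_poly 1 != fps_zero.
Proof.
apply/eqP => /(congr1 (fun f => coefs f 0%N)) /=.
by rewrite coef1 => /eqP; rewrite oner_eq0.
Qed.

HB.instance Definition _ := GRing.Zmodule_isComNzRing.Build (fps F)
  fps_mulA fps_mulC fps_mul1 fps_mulDl fps_1_neq0.

(* [fps_inv_seq f n] lists the first [n] coefficients of the inverse of [f]. *)
Fixpoint fps_inv_seq f n : seq F :=
  if n is m.+1 then
    let s := fps_inv_seq f m in
    rcons s ((coefs f 0)^-1 *
      ((m == 0%N)%:R - \sum_(i < m) coefs f (m - i)%N * s`_i))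
  else [::].

(* Series with zero constant term are left fixed, the MathComp convention for
   the inverse of a non-unit. *)
Definition fps_inv f :=
  if coefs f 0 == 0 then f else Fps (fun n => (fps_inv_seq f n.+1)`_n).

Lemma size_fps_inv_seq f n : size (fps_inv_seq f n) = n.
Proof. by elim: n => //= n IHn; rewrite size_rcons IHn. Qed.

Lemma nth_fps_inv_seq f n i : (i < n)%N ->
  (fps_inv_seq f n)`_i = (fps_inv_seq f i.+1)`_i.
Proof.
elim: n => // n IHn; rewrite ltnS leq_eqVlt => /orP[/eqP -> //|lin].
by rewrite [LHS]/= nth_rcons size_fps_inv_seq lin IHn.
Qed.

Definition fps_unit : {pred fps F} := [pred f | coefs f 0 != 0].

Lemma fps_mulV : {in fps_unit, left_inverse 1 fps_inv *%R}.
Proof.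
move=> f; rewrite inE => f0; rewrite [LHS]mulrC /fps_inv (negbTE f0).
apply: fpsP => n; rewrite [RHS]/= coef1 [LHS]/= big_ord_recl /= subn0.
rewrite nth_rcons size_fps_inv_seq ltnn eqxx mulVKf //.
rewrite -[RHS](subrK (\sum_(i < n) coefs f (n - i)%N * (fps_inv_seq f n)`_i)).
congr (_ + _); rewrite (reindex_inj rev_ord_inj) /=; apply: eq_bigr => i _.
rewrite /bump /= add1n subnSK //.
by rewrite subKn ?(ltnW (ltn_ord i)) // [in RHS]nth_fps_inv_seq.
Qed.

Lemma fps_unitP : {in [predC fps_unit], fps_inv =1 id}.
Proof. by move=> f; rewrite !inE negbK /fps_inv => ->. Qed.

Lemma fps_unitPl f g : g * f = 1 -> fps_unit f.
Proof.
move=> /(congr1 (fun h => coefs h 0%N)) /=.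
rewrite big_ord1 coef1 /= => gf; rewrite /fps_unit inE; apply/eqP => f0.
by move: gf => /eqP; rewrite f0 mulr0 eq_sym oner_eq0.
Qed.

HB.instance Definition _ := GRing.ComNzRing_hasMulInverse.Build (fps F)
  fps_mulV fps_unitPl fps_unitP.

End FpsRing.

Notation "p %:S" := (fps_of_poly p)
  (at level 1, left associativity, format "p %:S") : ring_scope.

(** * Chebyshev polynomials of the first kind *)

Fixpoint chebT (F : fieldType) (k : nat) : {poly F} :=
  match k with
  | 0 => 1
  | k1.+1 => match k1 with
             | 0 => 'X
             | k2.+1 => 2%:R *: 'X * chebT F k1 - chebT F k2
             end
  end.

(* The polynomial [2 t^m T_m(t^-1 / 2)], expanded term by term; see
   [chebT_revE] for the identity in the field of rational functions. *)
Definition chebT_rev (F : fieldType) (m : nat) : {poly F} :=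
  \sum_(i < m.+1) (2%:R * (chebT F m)`_i / 2%:R ^+ i) *: 'X^(m - i).

Lemma size_chebT (F : fieldType) m : (size (chebT F m) <= m.+1)%N.
Proof.
have [k] := ubnP m; elim: k m => // k IHk [|[|m]] lmk.
- by rewrite /= size_poly1.
- by rewrite /= size_polyX.
- rewrite [chebT _ _]/= -/(chebT F m.+1); apply: (leq_trans (size_polyD _ _)).
  rewrite size_polyN geq_max; apply/andP; split; last first.
    by apply: (leq_trans (IHk m _)); [apply: ltnW | do 2 apply: leqW].
  rewrite -scalerAl; apply: (leq_trans (size_scale_leq _ _)).
  rewrite mulrC; have [->|T0] := eqVneq (chebT F m.+1) 0.
    by rewrite mul0r size_poly0.
  by rewrite size_mulX // ltnS IHk.
Qed.

Lemma chebT_revE (F : fieldType) (m : nat) : (2%:R : F) != 0 ->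
  tofrac (chebT_rev F m) =
  2%:R * (tofrac 'X) ^+ m *
    (map_poly (fun a : F => tofrac a%:P) (chebT F m)).[(tofrac 'X)^-1 / 2%:R].
Proof.
move=> F2; have X0 : tofrac ('X : {poly F}) != 0.
  by rewrite tofrac_eq0 polyX_eq0.
have tofracC a b : tofrac ((a * b : F)%:P) = tofrac a%:P * tofrac b%:P.
  by rewrite polyCM rmorphM.
have t2 : tofrac ((2%:R : F)%:P) = 2%:R by rewrite !rmorph_nat.
have t2n0 : (2%:R : {fraction {poly F}}) != 0.
  by rewrite -t2 tofrac_eq0 polyC_eq0.
have tV (i : nat) : tofrac ((2%:R ^+ i : F)^-1%:P) = (2%:R ^+ i)^-1.
  apply: (mulIf (expf_neq0 i t2n0)); rewrite mulVf ?expf_neq0 //.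
  by rewrite -t2 -tofracXn -tofracM -polyC_exp -polyCM mulVf ?expf_neq0 ?polyC1 ?tofrac1.
rewrite (@horner_coef_wide _ m.+1); last first.
  exact: (leq_trans (size_poly _ _) (size_chebT F m)).
rewrite mulr_sumr /chebT_rev rmorph_sum; apply: eq_bigr => i _.
rewrite coef_map_id0 ?rmorph0 //.
rewrite -mul_polyC rmorphM rmorphXn /= !tofracC tV t2 expfB_cond; last first.
  by rewrite (negbTE X0) add0n -ltnS.
rewrite expr_div_n exprVn -!mulrA; congr (_ * _).
by rewrite [in RHS]mulrCA; congr (_ * _); rewrite [LHS]mulrC -mulrA.
Qed.

(** * Binary dihedral groups *)

Section BinaryDihedral.
Variable R : realType.
Local Notation C := R[i].

Definition SU2 : set 'M[C]_2 := [set g | g \is unitarymx /\ \det g = 1].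

Definition subgroup_SU2 (H : set 'M[C]_2) : Prop :=
  [/\ H `<=` SU2, H 1%:M,
      forall g h, H g -> H h -> H (g *m h) &
      forall g, H g -> H (invmx g)].

Definition mx2 (a b c d : C) : 'M[C]_2 :=
  \matrix_(i, j) if i == 0 then (if j == 0 then a else b)
                 else (if j == 0 then c else d).

Definition zeta2n (n : nat) : C :=
  (cos (pi / n%:R) +i* sin (pi / n%:R))%C.

Definition Dx (n : nat) : 'M[C]_2 := mx2 (zeta2n n)^-1 0 0 (zeta2n n).
Definition Dy : 'M[C]_2 := mx2 0 'i%C 'i%C 0.

(* The subgroup of [SU2] generated by [Dx n] and [Dy]. *)
Definition binary_dihedral (n : nat) : set 'M[C]_2 :=
  [set g | forall H, subgroup_SU2 H -> H (Dx n) -> H Dy -> H g].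

Lemma mx2_SU2 (a b c d : C) :
  a * a^*%C + b * b^*%C = 1 -> a * c^*%C + b * d^*%C = 0 ->
  c * c^*%C + d * d^*%C = 1 -> a * d - b * c = 1 -> SU2 (mx2 a b c d).
Proof.
move=> h11 h12 h22 hdet; split.
  apply/unitarymxP/matrixP => i j.
  rewrite !mxE big_ord_recl big_ord1 !mxE /=.
  have conjE z : (z^* = z^*%C)%R by [].
  case: i => [[|[|//]] ?]; case: j => [[|[|//]] ?] /=; rewrite ?conjE //.
  by rewrite -[RHS](rmorph0 (@conjc R)) -h12 rmorphD !rmorphM /= !conjcK
             mulrC [X in _ + X]mulrC.
rewrite (expand_det_row _ ord0) big_ord_recl big_ord1 /cofactor !det_mx11 !mxE /=.
by rewrite expr0 expr1 mul1r mulN1r mulrN.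
Qed.

Lemma zeta2n_norm n : zeta2n n * (zeta2n n)^*%C = 1.
Proof.
rewrite /zeta2n; apply/eqP; rewrite eq_complex /= -!expr2 !mulrN opprK -!expr2.
by rewrite cos2Dsin2 eqxx mulrC addrC subrr eqxx.
Qed.

Lemma Dx_SU2 n : SU2 (Dx n).
Proof.
have z0 : zeta2n n != 0.
  by apply/eqP => z0; have /eqP := zeta2n_norm n; rewrite z0 mul0r eq_sym oner_eq0.
have zV : (zeta2n n)^-1 = (zeta2n n)^*%C.
  by apply: (mulfI z0); rewrite mulfV // zeta2n_norm.
apply: mx2_SU2; rewrite ?rmorph0 ?mulr0 ?mul0r ?addr0 ?add0r ?subr0 //.
- by rewrite zV conjcK mulrC zeta2n_norm.
- exact: zeta2n_norm.
- by rewrite mulVf.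
Qed.

Lemma Dy_SU2 : SU2 Dy.
Proof.
have ii : ('i%C : C) * ('i%C)^*%C = 1.
  by apply/eqP; rewrite eq_complex /= !mul0r !mulr0 mulrN mul1r opprK add0r addr0 !eqxx.
have i2 : ('i%C : C) * 'i%C = -1.
  by apply/eqP; rewrite eq_complex /= !mul0r !mulr0 mul1r sub0r addr0 oppr0 !eqxx.
apply: mx2_SU2; rewrite ?rmorph0 ?mulr0 ?mul0r ?addr0 ?add0r //.
by rewrite i2 opprK.
Qed.

Lemma binary_dihedral_subgroup n : subgroup_SU2 (binary_dihedral n).
Proof.
split.
- have SU2g : subgroup_SU2 SU2.
    split=> //.
    + split; last by rewrite det1.
      by apply/unitarymxP; rewrite trmx1 map_mx1 mulmx1.
    + move=> g h [gU gd] [hU hd]; split; first exact: mul_unitarymx.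
      by rewrite det_mulmx gd hd mulr1.
    + move=> g [gU gd]; split; last by rewrite det_inv gd invr1.
      by rewrite (invmx_unitary gU) trmxC_unitary.
  by move=> g; apply=> //; [exact: Dx_SU2 | exact: Dy_SU2].
- by move=> H [].
- move=> g h gG hG H sH Hx Hy; case: (sH) => _ _ mH _.
  by apply: mH; [exact: gG | exact: hG].
- move=> g gG H sH Hx Hy; case: (sH) => _ _ _ iH.
  by apply: iH; exact: gG.
Qed.

End BinaryDihedral.

Arguments binary_dihedral : clear implicits.

(** * Invariants in tensor powers *)

Lemma vspace_of_linear (F : fieldType) (V : vectType F) (P : set V) :
  P 0 -> (forall a u v, P u -> P v -> P (a *: u + v)) ->
  exists U : {vspace V}, forall v, v \in U <-> P v.
Proof.
move=> P0 PZD.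
pose Q d := `[< exists U : {vspace V}, (forall v, v \in U -> P v) /\ \dim U = d >].
have Q0 : exists d, Q d.
  exists 0%N; apply/asboolP; exists 0%VS; split; last exact: dimv0.
  by move=> v; rewrite memv0 => /eqP ->.
have Qle d : Q d -> (d <= \dim {:V})%N.
  by move=> /asboolP[U [_ <-]]; rewrite dimvS ?subvf.
case: (ex_maxnP Q0 Qle) => d /asboolP[U [UP dU]] dmax.
exists U => v; split; first exact: UP.
move=> Pv; have QUv : Q (\dim (<[v]> + U)).
  apply/asboolP; exists (<[v]> + U)%VS; split=> // w /memv_addP[u].
  by move=> /vlineP[a ->] [u' u'U ->]; apply: PZD => //; exact: UP.
have /eqP -> : U == (<[v]> + U)%VS.
  by rewrite eqEdim addvSr dU dmax.
by apply: (subvP (addvSl _ _)); rewrite memv_line.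
Qed.

(* For V = F^d, the tensor power V^(⊗k) is F^(d^k) in the basis of pure tensors
   of standard basis vectors, and g acts on it by its k-th Kronecker power. *)
Lemma tensor_invariants_ex (F : fieldType) (d : nat) (G : set 'M[F]_d) (k : nat) :
  exists U : {vspace 'cV[F]_(d ^ k)},
    forall v, v \in U <-> forall g, G g -> (g ^t k) *m v = v.
Proof.
apply: (vspace_of_linear
  (P := [set v : 'cV[F]_(d ^ k) | forall g, G g -> (g ^t k) *m v = v])).
  by move=> g _; rewrite mulmx0.
by move=> a u v Pu Pv g Gg; rewrite mulmxDr -scalemxAr Pu // Pv.
Qed.

Definition tensor_invariants (F : fieldType) (d : nat) (G : set 'M[F]_d)
  (k : nat) : {vspace 'cV[F]_(d ^ k)} := projT1 (cid (tensor_invariants_ex G k)).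

Lemma tensor_invariantsP (F : fieldType) (d : nat) (G : set 'M[F]_d) k v :
  v \in tensor_invariants G k <-> forall g, G g -> (g ^t k) *m v = v.
Proof. exact: (projT2 (cid (tensor_invariants_ex G k)) v). Qed.

Definition poincare_series (R : realType) (n : nat) : fps R :=
  Fps (fun k => (\dim (tensor_invariants (binary_dihedral R n) k))%:R).

(* Main.v *)
(** In the basis of [V^(⊗k)] indexed by words in two letters, [x] is diagonal
    with entries [zeta_2n ^ weight] and [y] is [i^k] times the permutation that
    flips all letters.  Hence for [k > 0] twice the dimension of the invariants
    is the number of words whose weight is [0] modulo [2n].  The generating
    functions [f_j] of the words of weight [j] modulo [2n] satisfy
    [f_j = [j = 0] + t (f_(j-1) + f_(j+1))] together with [f_(-j) = f_j]; with
    [W_m = 2 t^m T_m(1/(2t))], so that [W_(m+2) = W_(m+1) - t^2 W_m], the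
    solution is [f_j = t^j W_(n-j) / D] for [0 <= j <= n], where
    [D = W_n - 2 t^2 W_(n-1)] is [1 - 4 t^2] times the reversed Chebyshev
    polynomial of the second kind.  Therefore
    [m^0 = (1 + f_0) / 2 = (D + W_n) / (2 D) = W_(n+1) / D]. *)

From HB Require Import structures.
Require Import Defs.
From mathcomp Require Import all_boot all_order all_algebra.
From mathcomp Require Import all_classical all_reals all_analysis.
From mathcomp Require Import complex mxtens.
From mathcomp Require Import ring zify.
Import Order.TTheory GRing.Theory Num.Theory.
Local Open Scope ring_scope.

Set Implicit Arguments.
Unset Strict Implicit.
Unset Printing Implicit Defensive.

(** * Chebyshev polynomials, reversed *)

(* For [a = 2] this is [2 T_m(X / 2)], for [a = 1] it is [U_m(X / 2)]. *)
Fixpoint lucas (F : fieldType) (a : F) (m : nat) : {poly F} :=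
  match m with
  | 0 => a%:P
  | m1.+1 => if m1 is m2.+1 then 'X * lucas a m1 - lucas a m2 else 'X
  end.

(* [t^m L_m(1/t)] for [L = lucas a]. *)
Fixpoint lucas_rev (F : fieldType) (a : F) (m : nat) : {poly F} :=
  match m with
  | 0 => a%:P
  | m1.+1 => if m1 is m2.+1 then lucas_rev a m1 - 'X^2 * lucas_rev a m2 else 1
  end.

Lemma lucasSS (F : fieldType) (a : F) m :
  lucas a m.+2 = 'X * lucas a m.+1 - lucas a m.
Proof. by []. Qed.

Lemma lucas_revSS (F : fieldType) (a : F) m :
  lucas_rev a m.+2 = lucas_rev a m.+1 - 'X^2 * lucas_rev a m.
Proof. by []. Qed.

Lemma chebTSS (F : fieldType) m :
  chebT F m.+2 = 2%:R *: 'X * chebT F m.+1 - chebT F m.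
Proof. by []. Qed.

Lemma nat_ind2 (P : nat -> Prop) : P 0%N -> P 1%N ->
  (forall m, P m -> P m.+1 -> P m.+2) -> forall m, P m.
Proof.
move=> P0 P1 PS m; suff [] : P m /\ P m.+1 by [].
by elim: m => // m [Pm Pm1]; split=> //; apply: PS.
Qed.

Lemma horner_lucas_rev (F : fieldType) (a t : F) m : t != 0 ->
  (lucas_rev a m).[t] = t ^+ m * (lucas a m).[t^-1].
Proof.
move=> t0; elim/nat_ind2: m => [||m IH0 IH1].
- by rewrite /= !hornerC mul1r.
- by rewrite /= hornerC hornerX expr1 mulfV.
- rewrite lucasSS lucas_revSS !hornerE IH0 IH1 !exprS; field.
  exact: t0.
Qed.

Lemma horner_lucas2 (F : fieldType) (x : F) m :
  (lucas 2%:R m).[2%:R * x] = 2%:R * (chebT F m).[x].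
Proof.
elim/nat_ind2: m => [||m IH0 IH1].
- by rewrite /= !hornerC mulr1.
- by rewrite /= !hornerX.
- by rewrite lucasSS chebTSS !hornerE IH0 IH1; ring.
Qed.

(** The index starts at 1 because [lucas a 0] is the constant [a], which need not be monic. Degree
    and leading coefficient let a full list of distinct roots determine the polynomial. *)
Lemma size_lucas (F : fieldType) (a : F) m :
  lucas a m.+1 \is monic /\ size (lucas a m.+1) = m.+2.
Proof.
elim/nat_ind2: m => [||m [_ s0] [m1 s1]].
- by rewrite /= monicX size_polyX.
- rewrite lucasSS; have sz : (size (- lucas a 0)%R < size ('X * lucas a 1)%R)%N.
    rewrite size_polyN /= -expr2 size_polyXn; exact: leq_ltn_trans (size_polyC_leq1 _) _.
  split; last by rewrite size_polyDl //= -expr2 size_polyXn.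
  by rewrite monicE lead_coefDl //= lead_coefM lead_coefX mulr1.
- have s2 : size ('X * lucas a m.+2)%R = m.+4.
    by rewrite mulrC size_mulX ?s1 // -size_poly_eq0 s1.
  rewrite lucasSS; have sz : (size (- lucas a m.+1)%R < size ('X * lucas a m.+2)%R)%N.
    by rewrite s2 size_polyN s0 ltnS.
  split; last by rewrite size_polyDl.
  by rewrite monicE lead_coefDl // lead_coefM lead_coefX mul1r (monicP m1).
Qed.

(** A nonzero difference would vanish at the nonzero points 1, ..., [size (p - q)], too many for its
    degree. This allows polynomial identities to be checked after substituting t^-1. *)
Lemma poly_eq_off0 (R : numFieldType) (p q : {poly R}) :
  (forall t, t != 0 -> p.[t] = q.[t]) -> p = q.
Proof.
move=> pq; apply/eqP; rewrite -subr_eq0; apply/negPn/negP => r0.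
pose s := [seq i.+1%:R : R | i <- iota 0 (size (p - q))].
have us : uniq s.
  rewrite map_inj_uniq ?iota_uniq // => i j /eqP.
  by rewrite eqr_nat => /eqP [].
have rs : all (root (p - q)) s.
  apply/allP => x /mapP [i _ ->]; rewrite rootE hornerD hornerN pq ?subrr ?eqxx //.
by have := max_poly_roots r0 rs us; rewrite size_map size_iota ltnn.
Qed.

(** Reversal sends X - x to 1 - x t: the factor t^(m+1) is shared out among the m+1 linear factors
    of [lucas a m.+1]. *)
Lemma lucas_rev_prod (R : numFieldType) (a : R) m (c : seq R) :
  size c = m.+1 -> uniq c -> (forall x, x \in c -> root (lucas a m.+1) x) ->
  lucas_rev a m.+1 = \prod_(x <- c) (1 - x *: 'X).
Proof.
move=> sc uc rc; have [mon sz] := size_lucas a m.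
have Lc : lucas a m.+1 = \prod_(x <- c) ('X - x%:P).
  rewrite (@all_roots_prod_XsubC _ (lucas a m.+1) c); first by rewrite (monicP mon) scale1r.
  - by rewrite sz sc.
  - by apply/allP.
  - by rewrite uniq_rootsE.
apply: poly_eq_off0 => t t0; rewrite horner_lucas_rev // Lc !horner_prod -sc.
have -> : t ^+ size c = \prod_(x <- c) t.
  by rewrite big_const_seq count_predT iter_mulr_1.
rewrite -big_split /=.
by apply: eq_bigr => x _; rewrite !hornerE; field.
Qed.

Lemma chebT_rev_lucas (R : numFieldType) m : chebT_rev R m = lucas_rev 2%:R m.
Proof.
apply: poly_eq_off0 => t t0; rewrite horner_lucas_rev //.
have -> : t^-1 = 2%:R * (2%:R * t)^-1 by field.
rewrite horner_lucas2 (horner_coef_wide _ (size_chebT R m)) /chebT_rev.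
rewrite horner_sum mulrCA !mulr_sumr; apply: eq_bigr => i _.
rewrite hornerZ hornerXn exprVn exprMn.
have -> : t ^+ m = t ^+ (m - i) * t ^+ i by rewrite -exprD subnK // -ltnS.
field.
by rewrite !expf_neq0 // pnatr_eq0.
Qed.

(** * The denominator identity and the expansions as sums *)

(** Both sides obey the recurrence of [lucas_rev]. This is T_m = x T_(m+1) + (1 - x^2) U_m, reversed
    at x = 1/(2t). *)
Lemma lucas_rev_denominator (F : fieldType) m :
  lucas_rev (2%:R : F) m.+1 - 2%:R *: 'X^2 * lucas_rev 2%:R m =
  (1 - 4%:R *: 'X^2) * lucas_rev 1 m.
Proof.
elim/nat_ind2: m => [||m IH0 IH1].
- by rewrite /= -!mul_polyC; ring.
- by rewrite /= -!mul_polyC; ring.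
- have -> : (1 - 4%:R *: 'X^2) * lucas_rev 1 m.+2 =
      (1 - 4%:R *: 'X^2) * lucas_rev 1 m.+1 -
      'X^2 * ((1 - 4%:R *: 'X^2) * lucas_rev 1 m) :> {poly F}.
    by rewrite lucas_revSS; ring.
  rewrite -IH0 -IH1 -!mul_polyC.
  by rewrite !(lucas_revSS _ m.+1) (lucas_revSS _ m); ring.
Qed.

(** Pascal's rule matches the recurrence. Terms with 2r > m vanish, so [N] is free; the induction
    takes the sum for [m] one term shorter, to line up after an index shift. *)
Lemma lucas_rev1_sum (F : fieldType) m N : (m < N)%N ->
  lucas_rev (1 : F) m =
  \sum_(0 <= r < N) ((-1) ^+ r * 'C(m - r, r)%:R) *: 'X^(2 * r).
Proof.
elim/nat_ind2: m N => [||m IH0 IH1] N.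
- case: N => // N _; rewrite big_nat_recl //= big1 ?addr0.
    by rewrite mul1r scale1r.
  by move=> i _; rewrite sub0n mulr0 scale0r.
- case: N => // N _; rewrite big_nat_recl //= big1 ?addr0.
    by rewrite mul1r scale1r.
  by move=> i _; rewrite subSS sub0n mulr0 scale0r.
- case: N => // N; rewrite ltnS => lmN.
  rewrite lucas_revSS (IH1 N.+1) ?leqW // (IH0 N) 1?ltnW //.
  rewrite !big_nat_recl // !bin0 -addrA; congr (_ + _).
  rewrite mulr_sumr -sumrB; apply: eq_bigr => i _.
  rewrite -scalerAr -exprD mulnS -scalerBl; congr (_ *: _).
  rewrite exprS mulN1r !mulNr -opprD -mulrDr -natrD; congr (- (_ * _%:R)).
  (* For [i] above [m] the truncated differences are 0 and all three binomials vanish. *)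
  rewrite !subSS; case: (leqP i m) => [im|mi]; last first.
    by rewrite !bin_small //; lia.
  by rewrite subSn // binS.
Qed.

(** With d = 1 - 4t^2, the recurrence has characteristic roots (1 + sqrt d)/2 and (1 - sqrt d)/2.
    The sums [E k] and [O k] play the parts in (1 + sqrt d)^k = E k + O k sqrt d, so no square root
    has to be adjoined. *)
Lemma lucas_rev2_sum (R : numFieldType) m N : (m < N)%N ->
  2%:R ^+ m *: lucas_rev (2%:R : R) m =
  2%:R *: \sum_(0 <= r < N) 'C(m, 2 * r)%:R *: (1 - 4%:R *: 'X^2) ^+ r.
Proof.
set d := 1 - _ => mN.
pose O k := \sum_(0 <= r < N) 'C(k, (2 * r).+1)%:R *: d ^+ r.
pose E k := \sum_(0 <= r < N) 'C(k, 2 * r)%:R *: d ^+ r.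
have OS k : O k.+1 = O k + E k.
  rewrite /O /E -big_split /=; apply: eq_bigr => i _.
  by rewrite binS natrD scalerDl.
have ES k : (k < N)%N -> E k.+1 = E k + d * O k.
  rewrite /O /E; case: N {O E OS mN} => // N kN.
  rewrite [LHS]big_nat_recl // [X in X + d * _]big_nat_recl // [X in d * X]big_nat_recr //=.
  (* Multiplication by [d] would push the top term of [O k] out of range; it is zero because [k] is
     below the number of terms. *)
  rewrite (@bin_small k (2 * N).+1); last by lia.
  rewrite scale0r addr0 !bin0 -addrA; congr (_ + _).
  rewrite mulr_sumr -big_split /=; apply: eq_bigr => i _.
  by rewrite mulnS binS natrD scalerDl exprS -scalerAr.
have E0 : E 0%N = 1.
  rewrite /E; case: N mN {O E OS ES} => // N _; rewrite big_nat_recl //= big1 ?addr0 ?scale1r //.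
  by move=> i _; rewrite scale0r.
have O0 : O 0%N = 0 by rewrite /O big1 // => i _; rewrite scale0r.
rewrite -/(E m); elim/nat_ind2: m mN => [||m IH0 IH1] mN.
- by rewrite E0 /= scale1r alg_polyC.
- by rewrite ES ?(ltn_trans _ mN) // E0 O0 mulr0 addr0 expr1.
- have {}IH0 := IH0 (ltnW (ltnW mN)); have {}IH1 := IH1 (ltnW mN).
  have mN1 := ltnW mN; have mN2 := ltnW mN1.
  (* Eliminating [O] reflects z^2 = 2 z + (d - 1) for z = 1 + sqrt d. *)
  have -> : E m.+2 = 2%:R * E m.+1 + (d - 1) * E m.
    rewrite ES // OS mulrDr.
    have -> : d * O m = E m.+1 - E m by rewrite ES //; ring.
    by ring.
  have -> : 2%:R *: (2%:R * E m.+1 + (d - 1) * E m) =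
      2%:R * (2%:R *: E m.+1) + (d - 1) * (2%:R *: E m).
    by rewrite scalerDr !scalerAr.
  rewrite -IH0 -IH1 lucas_revSS /d !exprS -!mul_polyC !polyCM; ring.
Qed.

(** * Roots and roots of unity *)

Section Trig.
Variable R : realType.

Lemma cos_step (x y : R) :
  cos (x + y) = 2%:R * cos y * cos x - cos (x - y).
Proof. by rewrite cosD cosB; ring. Qed.

Lemma sin_step (x y : R) :
  sin (x + y) = 2%:R * cos y * sin x - sin (x - y).
Proof. by rewrite sinD sinB; ring. Qed.

Lemma lucas2_cos (x : R) m :
  (lucas (2%:R : R) m).[2%:R * cos x] = 2%:R * cos (m%:R * x).
Proof.
elim/nat_ind2: m => [||m IH0 IH1].
- by rewrite /= hornerC mul0r cos0 mulr1.
- by rewrite /= hornerX mul1r.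
- rewrite lucasSS !hornerE IH0 IH1.
  have -> : m.+2%:R * x = m.+1%:R * x + x by rewrite -[m.+2]addn1 natrD; ring.
  rewrite cos_step.
  have -> : m.+1%:R * x - x = m%:R * x by rewrite -[m.+1]addn1 natrD; ring.
  by ring.
Qed.

Lemma lucas1_sin (x : R) m :
  (lucas (1 : R) m).[2%:R * cos x] * sin x = sin (m.+1%:R * x).
Proof.
elim/nat_ind2: m => [||m IH0 IH1].
- by rewrite /= hornerC !mul1r.
- have -> : 2%:R * x = x + x by ring.
  by rewrite /= hornerX sinD; ring.
- rewrite lucasSS !hornerE mulrBl -mulrA IH0 IH1.
  have -> : m.+3%:R * x = m.+2%:R * x + x by rewrite -[m.+3]addn1 natrD; ring.
  rewrite sin_step.
  have -> : m.+2%:R * x - x = m.+1%:R * x by rewrite -[m.+2]addn1 natrD; ring.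
  by ring.
Qed.

Lemma sin_natpi m : sin (m%:R * pi) = 0 :> R.
Proof.
elim: m => [|m IH]; first by rewrite mul0r sin0.
by rewrite -addn1 natrD mulrDl mul1r sinDpi IH oppr0.
Qed.

Lemma cos_halfnatpi m : cos (m%:R * pi + pi / 2%:R) = 0 :> R.
Proof. by rewrite cosDpihalf sin_natpi oppr0. Qed.

Lemma uniq_2cos (th : nat -> R) (s : seq nat) : uniq s ->
  (forall r, r \in s -> 0 <= th r <= pi) -> {in s &, injective th} ->
  uniq [seq 2%:R * cos (th r) | r <- s].
Proof.
move=> us ths inj; rewrite map_inj_in_uniq // => i j si sj.
move=> /(mulfI _) e; apply: inj => //; apply: cos_inj; rewrite ?in_itv /= ?ths //.
by apply: e; rewrite pnatr_eq0.
Qed.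

(** Multiplied by m+1, each angle is an odd multiple of pi/2, where cosine vanishes. The angles are
    distinct in [0, pi], so injectivity of cosine there yields all m+1 roots. *)
Lemma lucas_rev2_prod m : lucas_rev (2%:R : R) m.+1 =
  \prod_(1 <= r < m.+2)
    (1 - (2%:R * cos ((2 * r - 1)%:R * pi / (2 * m.+1)%:R)) *: 'X).
Proof.
pose th r : R := (2 * r - 1)%:R * pi / (2 * m.+1)%:R.
have m0 : (2 * m.+1)%:R != 0 :> R by rewrite pnatr_eq0.
have pi0 : pi != 0 :> R by rewrite gt_eqF ?pi_gt0.
pose s := index_iota 1 m.+2.
rewrite -(big_map (fun r => 2%:R * cos (th r)) xpredT
          (fun x => 1 - x *: 'X)).
apply: lucas_rev_prod; first by rewrite size_map size_iota subn1.
- apply: uniq_2cos; first exact: iota_uniq.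
  + move=> r; rewrite mem_index_iota => /andP[r1 rm].
    rewrite /th !mulr_ge0 ?invr_ge0 ?ler0n ?pi_ge0 //= ler_pdivrMr ?ltr0n //.
    by rewrite mulrC ler_wpM2l ?pi_ge0 // ler_nat; lia.
  + move=> i j; rewrite !mem_index_iota => /andP[i1 _] /andP[j1 _].
    rewrite /th => /(mulIf (invr_neq0 m0)) /(mulIf pi0) /eqP; rewrite eqr_nat => /eqP.
    by lia.
- move=> x /mapP [r]; rewrite mem_index_iota => /andP[r1 rm] ->.
  rewrite rootE lucas2_cos; case: r r1 rm => // r _ _.
  have -> : m.+1%:R * th r.+1 = r%:R * pi + pi / 2%:R.
    rewrite /th; have -> : (2 * r.+1 - 1 = 2 * r + 1)%N by lia.
    rewrite !natrM natrD natrM; field.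
    by rewrite nat1r pnatr_eq0.
  by rewrite cos_halfnatpi mulr0.
Qed.

(** The angles are the zeros of sin(m x) strictly between 0 and pi, where sin x is nonzero and can
    be cancelled in [lucas1_sin]. *)
Lemma lucas_rev1_prod m : (0 < m)%N -> lucas_rev (1 : R) m.-1 =
  \prod_(1 <= r < m) (1 - (2%:R * cos (pi * r%:R / m%:R)) *: 'X).
Proof.
case: m => // [[|m]] _; first by rewrite big_geq.
pose th r : R := pi * r%:R / m.+2%:R.
have m0 : m.+2%:R != 0 :> R by rewrite pnatr_eq0.
have pi0 : pi != 0 :> R by rewrite gt_eqF ?pi_gt0.
rewrite [_.-1]/= -(big_map (fun r => 2%:R * cos (th r)) xpredT
          (fun x => 1 - x *: 'X)).
apply: lucas_rev_prod; first by rewrite size_map size_iota subn1.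
- apply: uniq_2cos; first exact: iota_uniq.
  + move=> r; rewrite mem_index_iota => /andP[r1 rm].
    rewrite /th !mulr_ge0 ?invr_ge0 ?ler0n ?pi_ge0 //= ler_pdivrMr ?ltr0n //.
    by rewrite ler_wpM2l ?pi_ge0 // ler_nat; lia.
  + move=> i j _ _; rewrite /th => /(mulIf (invr_neq0 m0)) /(mulfI pi0) /eqP.
    by rewrite eqr_nat => /eqP.
- move=> x /mapP [r]; rewrite mem_index_iota => /andP[r1 rm] ->.
  rewrite rootE; have s0 : sin (th r) != 0.
    rewrite gt_eqF // sin_gt0_pi // /th divr_gt0 ?mulr_gt0 ?pi_gt0 ?ltr0n //=.
    by rewrite ltr_pdivrMr ?ltr0n // ltr_pM2l ?pi_gt0 // ltr_nat.
  rewrite -(mulIr_eq0 _ (mulIf s0)) lucas1_sin.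
  have -> : m.+2%:R * th r = r%:R * pi by rewrite /th; field.
  by rewrite sin_natpi.
Qed.

Lemma zetaX n m :
  zeta2n R n ^+ m = (cos (m%:R * (pi / n%:R)) +i* sin (m%:R * (pi / n%:R)))%C.
Proof.
elim: m => [|m IH]; first by rewrite expr0 mul0r cos0 sin0.
have -> : m.+1%:R * (pi / n%:R) = m%:R * (pi / n%:R) + pi / n%:R :> R.
  by rewrite -[m.+1]addn1 natrD mulrDl mul1r.
rewrite exprSr IH /zeta2n cosD sinD.
by apply/eqP; rewrite eq_complex /= addrC !eqxx /= addrC.
Qed.

(** A proper divisor of 2n is at most n. It cannot be n, since the n-th power is -1, nor some 0 < m
    < n, since the m-th power has imaginary part sin(m pi / n) > 0. *)
Lemma zeta_prim n : (0 < n)%N -> (2 * n).-primitive_root (zeta2n R n).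
Proof.
move=> n0; have n0R : n%:R != 0 :> R by rewrite pnatr_eq0 -lt0n.
have zn : zeta2n R n ^+ n = -1.
  rewrite zetaX mulrCA mulfV // mulr1 cospi sinpi.
  by apply/eqP; rewrite eq_complex /= oppr0 !eqxx.
have znn : zeta2n R n ^+ (2 * n) = 1 by rewrite mulnC exprM zn sqrrN expr1n.
have n2 : (0 < 2 * n)%N by rewrite muln_gt0.
have [m mz mn] := prim_order_exists n2 znn.
have m0 := prim_order_gt0 mz; have zm := prim_expr_order mz.
suff /eqP <- : m == (2 * n)%N by [].
have := dvdn_leq n2 mn; rewrite leq_eqVlt => /orP[//|m2n]; exfalso.
have lemn : (m <= n)%N.
  by case/dvdnP: mn m2n => -[|[|q]] e m2n; move: n0 m2n; nia.
move: lemn; rewrite leq_eqVlt => /orP[/eqP emn|ltmn].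
  by move: zm; rewrite emn zn => /eqP; rewrite eqNr oner_eq0.
have s0 : 0 < sin (m%:R * (pi / n%:R)) :> R.
  rewrite sin_gt0_pi // mulr_gt0 ?divr_gt0 ?pi_gt0 ?ltr0n //=.
  by rewrite mulrCA gtr_pMr ?pi_gt0 // ltr_pdivrMr ?ltr0n // mul1r ltr_nat.
by move: zm; rewrite zetaX => -[_ s1]; move: s0; rewrite s1 ltxx.
Qed.

End Trig.

(** * Tensor powers and signed involutions *)

(** A single bijection of indices with words serves all matrices, so both generators can be computed
    in the same basis. *)
Lemma ntensmx_entries (d k : nat) :
  exists2 w : 'I_(d ^ k) -> k.-tuple 'I_d, bijective w &
  forall (F : fieldType) (A : 'M[F]_d) i j,
    (A ^t k) i j = \prod_(l < k) A (tnth (w i) l) (tnth (w j) l).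
Proof.
suff [w wi wA] : exists2 w : 'I_(d ^ k) -> k.-tuple 'I_d, injective w &
  forall (F : fieldType) (A : 'M[F]_d) i j,
    (A ^t k) i j = \prod_(l < k) A (tnth (w i) l) (tnth (w j) l).
  exists w => //; apply: inj_card_bij => //.
  by rewrite card_tuple !card_ord.
(* The Kronecker power unfolds as a product from exponent 2 on, so 0 and 1 are both base cases. *)
case: k => [|k].
  exists (fun=> [tuple]); first by move=> i j _; apply: val_inj; rewrite !ord1.
  by move=> F A i j; rewrite big_ord0 ntensmx0 !ord1 mxE eqxx.
elim: k => [|k [w wi wA]].
  exists (fun i => [tuple i]); first by move=> i j /(congr1 (@thead _ _)).
  by move=> F A i j; rewrite big_ord1.
exists (fun i : 'I_(d * d ^ k.+1) =>
   [tuple of (mxtens_unindex i).1 :: w (mxtens_unindex i).2]).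
  move=> i j /(congr1 val) [e1 /val_inj/wi e2].
  rewrite -[ i]mxtens_unindexK -[j]mxtens_unindexK; congr mxtens_index.
  by rewrite [LHS]surjective_pairing [RHS]surjective_pairing; congr pair => //; apply: val_inj.
move=> F A i j; rewrite ntensmxSS big_ord_recl [LHS]mxE wA; congr (_ * _).
by apply: eq_bigr => l _; rewrite !tnthS.
Qed.

Lemma ntensmxM (F : fieldType) d (A B : 'M[F]_d) k :
  (A *m B) ^t k = (A ^t k) *m (B ^t k).
Proof.
case: k => [|k]; first by rewrite !ntensmx0 mulmx1.
by elim: k => // k IH; rewrite !ntensmxSS tensmx_mul IH.
Qed.

Lemma ntens1mx (F : fieldType) d k : (1%:M : 'M[F]_d) ^t k = 1%:M.
Proof.
have [w [w' wK w'K] wA] := ntensmx_entries d k.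
apply/matrixP => i j; rewrite wA mxE -(can_eq wK).
have [->|/eqP nij] := eqVneq (w i) (w j).
  by rewrite big1 // => l _; rewrite mxE eqxx.
have [l nl] : exists l, tnth (w i) l != tnth (w j) l.
  apply/existsP; rewrite -negb_forall; apply/negP => /forallP e; apply: nij.
  by apply: eq_from_tnth => l; apply/eqP.
by rewrite (bigD1 l) //= mxE (negbTE nl) mul0r.
Qed.

(* An invariant vector is determined by its values on one point of each
   [c]-orbit in [P]. *)
Lemma dim_signed_involution (F : fieldType) m (c : 'I_m -> 'I_m) (P : pred 'I_m)
    (e : F) (U : {vspace 'cV[F]_m}) :
  involutive c -> (forall i, P (c i) = P i) -> (forall i, P i -> c i != i) ->
  (forall i, P i -> e * e = 1) ->
  (forall v, v \in U <-> (forall i, ~~ P i -> v i 0 = 0) /\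
                         (forall i, v (c i) 0 = e * v i 0)) ->
  (2 * \dim U = #|P|)%N.
Proof.
move=> cK Pc Pn ee UP.
(* The smaller index represents each two-element orbit. *)
pose A := [set i | P i & (i < c i)%N].
pose r (v : 'cV[F]_m) : 'cV[F]_#|A| := \col_k v (enum_val k) 0.
have r_lin : linear r by move=> a u v; apply/colP => k; rewrite !mxE.
pose rL := GRing.isLinear.Build _ _ _ _ r r_lin.
pose r' : {linear 'cV[F]_m -> 'cV[F]_#|A|} := HB.pack r rL.
have PA i : P i = (i \in A) || (c i \in A).
  rewrite !inE Pc cK; case Pi: (P i) => //=.
  by have := Pn _ Pi; rewrite -val_eqE /=; case: ltngtP.
have AcA i : ~~ ((i \in A) && (c i \in A)).
  by rewrite !inE cK; case: ltngtP; rewrite ?andbF.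
have dimA : \dim U = #|A|.
  have ker0 : (U :&: lker (linfun r') = 0)%VS.
    apply/eqP; rewrite -subv0; apply/subvP => v; rewrite memv_cap memv_ker memv0.
    move=> /andP[/UP [vP vc] /eqP]; rewrite lfunE /= => /colP rv0.
    have vA i : i \in A -> v i 0 = 0.
      by move=> iA; have := rv0 (enum_rank_in iA i); rewrite !mxE enum_rankK_in.
    apply/eqP/colP => i; rewrite mxE; case Pi: (P i); last by rewrite vP ?Pi.
    move: Pi; rewrite PA => /orP[/vA //|/vA].
    by move=> vci; rewrite -[ i]cK vc vci mulr0.
  rewrite -(limg_dim_eq ker0); suff -> : (linfun r' @: U = fullv)%VS.
    by rewrite dimvf /dim /= muln1.
  apply/vspaceP => u; rewrite memvf; apply/memv_imgP.
  (* [u'] extends [u] by zero outside [A]. Adding [e] times its reflection gives a vector of [U]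
     that still restricts to [u], because [A] and its image under [c] are disjoint. *)
  pose u' i : F := \sum_(k < #|A| | enum_val k == i) u k 0.
  have u'0 i : i \notin A -> u' i = 0.
    by move=> iA; rewrite /u' big1 // => k /eqP e1; move: iA; rewrite -e1 enum_valP.
  exists (\col_i (u' i + e * u' (c i))).
    apply/UP; split=> i; rewrite !mxE.
      by rewrite PA negb_or => /andP[/u'0 -> /u'0 ->]; rewrite mulr0 addr0.
    rewrite cK mulrDr mulrA addrC; case Pi: (P i); first by rewrite (ee _ Pi) mul1r.
    by move: Pi; rewrite PA => /norP[/u'0 -> /u'0 ->]; rewrite !mulr0 addr0.
  rewrite lfunE /=; apply/colP => k; rewrite !mxE.
  have kA := enum_valP k; have := AcA (enum_val k); rewrite kA /= => /u'0 ->.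
  rewrite mulr0 addr0 /u' (bigD1 k) //= big1 ?addr0 // => l /andP[/eqP /enum_val_inj ->].
  by rewrite eqxx.
rewrite dimA; have -> : #|P| = #|A :|: (c @: A)|.
  apply: eq_card => i; rewrite -topredE /= PA finset.in_setU; congr orb.
  by rewrite -[X in _ = (X \in _)]cK finset.mem_imset //; exact: (can_inj cK).
rewrite cardsU (card_imset _ (can_inj cK)) mul2n -addnn.
suff -> : A :&: c @: A = finset.set0 by rewrite cards0 subn0.
apply/finset.setP => i; rewrite finset.in_setI finset.in_set0 -{2}[ i]cK.
rewrite finset.mem_imset; last exact: (can_inj cK).
exact: negbTE.
Qed.

(** * Invariants as words *)

(** The letter 0 counts -1 because the first diagonal entry of [Dx] is the inverse of [zeta2n]. *)
Definition weight k (t : k.-tuple 'I_2) : int :=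
  \sum_(l < k) (if tnth t l == 0 then -1 else 1).

Definition flip k (t : k.-tuple 'I_2) : k.-tuple 'I_2 := map_tuple (@rev_ord 2) t.

Lemma flipK k : involutive (@flip k).
Proof. by move=> t; apply: eq_from_tnth => l; rewrite !tnth_map rev_ordK. Qed.

Lemma rev_ord2_eq0 (i : 'I_2) : (rev_ord i == 0) = (i != 0).
Proof. by case: i => -[|[|]]. Qed.

Lemma ord2_neq (i j : 'I_2) : (i != j) = (j == rev_ord i).
Proof. by case: i j => -[|[|//]] ? [] [|[|]]. Qed.

Lemma weight_flip k (t : k.-tuple 'I_2) : weight (flip t) = - weight t.
Proof.
rewrite /weight -sumrN; apply: eq_bigr => l _.
by rewrite tnth_map rev_ord2_eq0; case: eqP; rewrite ?opprK.
Qed.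

Lemma weight_parity k (t : k.-tuple 'I_2) : (2 %| weight t + k%:Z)%Z.
Proof.
have -> : k%:Z = \sum_(l < k) 1 by rewrite sumr_const card_ord natz.
rewrite /weight -big_split /=; apply: (big_ind (fun x => (2 %| x)%Z)) => [|x y|].
- by [].
- exact: rpredD.
- by move=> l _; case: eqP.
Qed.

(** With an arbitrary predicate, removing the first letter of a word becomes a shift of the
    predicate. *)
Definition weight_count k (P : pred int) : nat :=
  #|[pred t : k.-tuple 'I_2 | P (weight t)]|.

Lemma weight_count0 P : weight_count 0 P = P 0.
Proof.
have P0 (t : 0.-tuple 'I_2) : P (weight t) = P 0 by rewrite /weight big_ord0.
rewrite /weight_count (eq_card (B := [pred _ | P 0])); last exact: P0.
by case: (P 0); rewrite ?card0 // card_tuple.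
Qed.

Lemma weight_countS k P :
  weight_count k.+1 P =
  (weight_count k (fun z => P (z - 1)%R) + weight_count k (fun z => P (z + 1)%R))%N.
Proof.
have sumE j Q : weight_count j Q = \sum_(t : j.-tuple 'I_2) (Q (weight t) : nat).
  rewrite /weight_count -sum1_card big_mkcond /=.
  by apply: eq_bigr => t _; rewrite inE; case: (Q _).
rewrite !sumE.
pose h (p : 'I_2 * k.-tuple 'I_2) := [tuple of p.1 :: p.2].
rewrite (reindex h) /=; last first.
  exists (fun t => (thead t, [tuple of behead t])) => [[i t] _|t _] /=.
    by congr pair; apply: val_inj.
  by apply: val_inj; rewrite /= [in RHS](tuple_eta t).
rewrite -(pair_big predT predT (fun i t => P (weight (h (i, t))) : nat)) /=.
rewrite big_ord_recl big_ord1; congr addn; apply: eq_bigr => t _;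
 congr (nat_of_bool (P _)); rewrite /weight big_ord_recl /= addrC; congr (_ + _);
 by apply: eq_bigr => l _; rewrite tnthS.
Qed.

Lemma eq_weight_count k P Q : P =1 Q -> weight_count k P = weight_count k Q.
Proof. by move=> PQ; apply: eq_card => t; rewrite !inE PQ. Qed.

Lemma weight_countN k P : weight_count k (fun z => P (- z)%R) = weight_count k P.
Proof.
rewrite /weight_count -(fintype.card_image (can_inj (@flipK k))).
apply: eq_card => t; rewrite -{1}[t]flipK fintype.mem_image; last exact: (can_inj (@flipK k)).
by rewrite !inE weight_flip opprK.
Qed.

Lemma prim_root_exprz (F : fieldType) n (z : F) (w : int) :
  n.-primitive_root z -> (z ^ w == 1) = (n %| w)%Z.
Proof.
move=> zn; case: w => m; first by rewrite -exprnP -(prim_order_dvd zn).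
by rewrite NegzE -exprnN invr_eq1 -(prim_order_dvd zn) rpredN.
Qed.

(** * Action of the generators on words and the dimension of the invariants *)

Section Dim.
Variable R : realType.

Lemma mulmx_ntens_Dx n k (w : 'I_(2 ^ k) -> k.-tuple 'I_2) v i : bijective w ->
  (forall (A : 'M[R[i]]_2) i j,
    (A ^t k) i j = \prod_(l < k) A (tnth (w i) l) (tnth (w j) l)) ->
  ((Dx R n ^t k) *m v) i (0 : 'I_1) = zeta2n R n ^ weight (w i) * v i 0.
Proof.
move=> [w' wK w'K] wA; rewrite mxE (bigD1 i) //= big1 ?addr0.
  rewrite wA; congr (_ * _); rewrite /weight.
  have z0 : zeta2n R n != 0.
    apply/eqP => z0; have /eqP := zeta2n_norm R n.
    by rewrite z0 mul0r eq_sym oner_eq0.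
  rewrite (big_morph (fun m : int => zeta2n R n ^ m) (fun a b => expfzDr a b z0) (expr0z _)).
  apply: eq_bigr => l _; rewrite mxE.
  by have [e|e] := eqVneq (tnth (w i) l) 0; rewrite ?exprN1 ?expr1z.
move=> j /negP nij.
have [l nl] : exists l, tnth (w i) l != tnth (w j) l.
  apply/existsP; rewrite -negb_forall; apply/negP => /forallP e; apply: nij.
  by apply/eqP/(can_inj wK)/eq_from_tnth => l; apply/esym/eqP.
rewrite wA (bigD1 l) //= mxE; move: nl.
by case: (tnth (w i) l) (tnth (w j) l) => -[|[|//]] ? [] [|[|//]] ? //= _; rewrite !mul0r.
Qed.

Lemma mulmx_ntens_Dy k (w : 'I_(2 ^ k) -> k.-tuple 'I_2) w' v i :
  cancel w w' -> cancel w' w ->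
  (forall (A : 'M[R[i]]_2) i j,
    (A ^t k) i j = \prod_(l < k) A (tnth (w i) l) (tnth (w j) l)) ->
  ((Dy R ^t k) *m v) i (0 : 'I_1) = 'i%C ^+ k * v (w' (flip (w i))) 0.
Proof.
move=> wK w'K wA; rewrite mxE (bigD1 (w' (flip (w i)))) //= big1 ?addr0.
  rewrite wA w'K; congr (_ * _).
  rewrite -[in RHS](card_ord k) -prodr_const; apply: eq_bigr => l _.
  by rewrite tnth_map mxE; case: (tnth (w i) l) => -[|[|//]].
move=> j /negP nij.
have [l nl] : exists l, tnth (w i) l == tnth (w j) l.
  apply/existsP; apply: contra_notT nij; rewrite negb_exists => /forallP e.
  rewrite -(can_eq wK) w'K; apply/eqP/eq_from_tnth => l; rewrite tnth_map.
  by apply/eqP; rewrite -ord2_neq.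
rewrite wA (bigD1 l) //= mxE; move: nl => /eqP ->.
by case: (tnth (w j) l) => -[|[|//]] ? /=; rewrite !mul0r.
Qed.

Lemma dihedral_invariantsP n k v :
  v \in tensor_invariants (binary_dihedral R n) k <->
  (Dx R n ^t k) *m v = v /\ (Dy R ^t k) *m v = v.
Proof.
rewrite tensor_invariantsP; split=> [vG|[vx vy] g gG].
  by split; apply: vG => H _ Hx Hy.
have [sSU S1 SM SV] := binary_dihedral_subgroup R n.
(* Elements of the group fixing [v] form a subgroup of SU2, so it suffices to
   look at the generators. *)
suff [] : [set g | binary_dihedral R n g /\ (g ^t k) *m v = v]%classic g by [].
apply: gG; last 2 first.
- by split=> // H _ Hx Hy.
- by split=> // H _ Hx Hy.
split.
- by move=> h [/sSU].
- by split=> //; rewrite ntens1mx mul1mx.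
- move=> a b [Ga va] [Gb vb]; split; first exact: SM.
  by rewrite ntensmxM -mulmxA vb.
- move=> a [Ga va]; split; first exact: SV.
  rewrite -{1}va mulmxA -ntensmxM mulVmx ?ntens1mx ?mul1mx //.
  by rewrite unitmxE; have [_ ->] := sSU _ Ga; rewrite unitr1.
Qed.

Lemma dim_dihedral_invariants0 n : \dim (tensor_invariants (binary_dihedral R n) 0) = 1%N.
Proof.
suff -> : tensor_invariants (binary_dihedral R n) 0 = fullv by rewrite dimvf.
apply/vspaceP => v; rewrite memvf; apply/tensor_invariantsP => g _.
by rewrite ntensmx0 mul1mx.
Qed.

Lemma dim_dihedral_invariants n k : (0 < n)%N -> (0 < k)%N ->
  (2 * \dim (tensor_invariants (binary_dihedral R n) k) =
   weight_count k (fun z => ((2 * n)%N %| z)%Z))%N.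
Proof.
move=> n0 k0; have [w [w' wK w'K] wA] := ntensmx_entries 2 k.
have wb : bijective w by exists w'.
pose c i := w' (flip (w i)).
pose P i := ((2 * n)%N %| weight (w i))%Z.
have cK : involutive c by move=> i; rewrite /c w'K flipK wK.
have wc i : weight (w (c i)) = - weight (w i) by rewrite w'K weight_flip.
rewrite (@dim_signed_involution _ _ c P ('i%C ^+ k)) //.
- have -> : #|P| = #|[pred i | P i]| by apply: eq_card.
  rewrite /weight_count -(fintype.card_image (can_inj wK)).
  apply: eq_card => t; rewrite -{1}[t]w'K fintype.mem_image; last exact: (can_inj wK).
  by rewrite !inE /P w'K.
- by move=> i; rewrite /P wc rpredN.
(* Since k > 0 there is a first letter, and the flip changes it. *)
- move=> i _; apply/eqP => /(congr1 w) /(congr1 (fun t => tnth t (Ordinal k0))).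
  rewrite w'K tnth_map => /eqP; rewrite eq_sym -ord2_neq.
  by rewrite eqxx.
(* The square of i^k is (-1)^k. A weight divisible by 2n is even and has the parity of k, so k is
   even as soon as such a word exists. *)
- move=> i Pi; rewrite -exprMn.
  have -> : 'i%C * 'i%C = -1 :> R[i].
    by apply/eqP; rewrite eq_complex /= !mul0r !mulr0 mul1r sub0r addr0 oppr0 !eqxx.
  have := weight_parity (w i); rewrite rpredDl; last first.
    apply: dvdz_trans Pi; exact: dvdn_mulr.
  rewrite dvdzE /= dvdn2 -signr_odd => /negbTE ->.
  by rewrite expr0.
- move=> v; rewrite dihedral_invariantsP; split.
    move=> [/colP vx /colP vy]; split=> i.
      rewrite /P -(prim_root_exprz _ (zeta_prim R n0)) => z1.
      have := vx i; rewrite (mulmx_ntens_Dx _ _ _ wb (wA _)) => /eqP.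
      rewrite -subr_eq0 -{2}[v i 0]mul1r -mulrBl mulf_eq0 subr_eq0 (negbTE z1).
      by move/eqP.
    by rewrite -(vy (c i)) (mulmx_ntens_Dy _ _ wK w'K (wA _)) -/(c _) cK.
  move=> [v0 vc]; split; apply/colP => i.
    rewrite (mulmx_ntens_Dx _ _ _ wb (wA _)); case Pi: (P i).
      by move: Pi; rewrite /P -(prim_root_exprz _ (zeta_prim R n0)) => /eqP ->; rewrite mul1r.
    by rewrite v0 ?Pi // mulr0.
  by rewrite (mulmx_ntens_Dy _ _ wK w'K (wA _)) -/(c i) -vc cK.
Qed.

End Dim.

(** * The generating function *)

Lemma coef_fpsD (F : fieldType) (f g : fps F) k :
  coefs (f + g) k = coefs f k + coefs g k.
Proof. by []. Qed.

Lemma coef_fps1 (F : fieldType) k : coefs (1 : fps F) k = (k == 0%N)%:R.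
Proof. exact: coef1. Qed.

Lemma fps_of_polyD (F : fieldType) (p q : {poly F}) : (p + q)%:S = p%:S + q%:S.
Proof. by apply: fpsP => k /=; rewrite coefD. Qed.

Lemma fps_of_polyM (F : fieldType) (p q : {poly F}) : (p * q)%:S = p%:S * q%:S.
Proof. by apply: fpsP => k /=; rewrite coefM. Qed.

Lemma coef_fpsXM (F : fieldType) (f : fps F) k :
  coefs ('X%:S * f) k = if k is k1.+1 then coefs f k1 else 0.
Proof.
case: k => [|k]; rewrite /= big_ord_recl coefX mul0r add0r ?big_ord0 //.
rewrite big_ord_recl coefX mul1r subn1 big1 ?addr0 // => i _.
by rewrite coefX mul0r.
Qed.

Lemma lucas_rev_coef0 (F : fieldType) (a : F) m : (lucas_rev a m.+1)`_0 = 1.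
Proof.
elim: m => [|m IH]; first by rewrite coef1.
by rewrite lucas_revSS coefB IH coefXnM subr0.
Qed.

Section Walk.
Variables (R : realType) (n : nat).
Hypothesis n_gt0 : (0 < n)%N.

Definition residue_count k (j : int) : nat :=
  weight_count k (fun z => ((2 * n)%N %| z - j)%Z).

Lemma residue_countS k j :
  residue_count k.+1 j = (residue_count k (j - 1) + residue_count k (j + 1))%N.
Proof.
rewrite /residue_count weight_countS addnC; congr addn;
  by apply: eq_weight_count => z; congr (_ %| _)%Z; ring.
Qed.

Lemma residue_countN k j : residue_count k (- j) = residue_count k j.
Proof.
rewrite /residue_count -weight_countN; apply: eq_weight_count => z.
by rewrite -rpredN; congr (_ %| _)%Z; ring.
Qed.

Lemma residue_countD2n k (j : int) :
  residue_count k (j + (2 * n)%N%:Z) = residue_count k j.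
Proof.
apply: eq_weight_count => z.
by rewrite opprD addrA rpredBr.
Qed.

Let W : nat -> {poly R} := lucas_rev 2%:R.
Let D : {poly R} := (1 - 4%:R *: 'X^2) * lucas_rev 1 n.-1.
(** [S j] is the numerator of the claimed f_j, meant for [j <= n] because of the truncated
    [n - j]. *)
Let S j : {poly R} := 'X^j * W (n - j).
Let G j : fps R := (S j)%:S / D%:S.

Lemma denominatorE : D = W n - 2%:R *: 'X^2 * W n.-1.
Proof. by rewrite /D -lucas_rev_denominator prednK. Qed.

Lemma denominator_coef0 : D`_0 = 1.
Proof.
rewrite denominatorE /W -(prednK n_gt0) /= coefB lucas_rev_coef0 -scalerAl coefZ coefXnM.
by rewrite mulr0 subr0.
Qed.

Lemma denominator_unit : D%:S \is a GRing.unit.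
Proof. by change (D`_0 != 0); rewrite denominator_coef0 oner_eq0. Qed.

(** Over the common denominator, each recurrence for [G] becomes a polynomial identity. *)
Lemma gf_step i j : 'X%:S * (G i + G j) = ('X * (S i + S j))%:S / D%:S.
Proof. by rewrite -mulrDl -fps_of_polyD mulrA -fps_of_polyM. Qed.

(** The residues 1 and -1 next to 0 share one series; clearing [D] leaves [denominatorE]. *)
Lemma gf0E : G 0%N = 1 + 'X%:S * (G 1%N + G 1%N).
Proof.
rewrite -(divrr denominator_unit) gf_step -mulrDl -fps_of_polyD.
congr (_%:S / _); rewrite /S denominatorE subn0 subn1 -mul_polyC; ring.
Qed.

(** The residue n + 1 is -(n - 1) modulo 2n, hence the doubled term. The identity rests on W_0 = 2
    and W_1 = 1. *)
Lemma gfnE : G n = 'X%:S * (G n.-1 + G n.-1).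
Proof.
rewrite gf_step; congr (_%:S / _); rewrite /S subnn.
have -> : (n - n.-1 = 1)%N by lia.
rewrite -{1}(prednK n_gt0) exprS.
by rewrite /W /=; ring.
Qed.

Lemma gfE j : (0 < j < n)%N -> G j = 'X%:S * (G j.-1 + G j.+1).
Proof.
case: j => // j jn; rewrite gf_step; congr (_%:S / _); rewrite /S /=.
have [p np] : exists p, n = (p + j.+2)%N by exists (n - j.+2)%N; lia.
have [-> -> ->] : [/\ n - j = p.+2, n - j.+1 = p.+1 & n - j.+2 = p]%N by split; lia.
by rewrite /W lucas_revSS !exprS; ring.
Qed.

(** Induction on [k] for all [j <= n] at once: the counts and the coefficients obey the same
    recurrence, closed up at 0 and n by reflection. *)
Lemma residue_gf k j : (j <= n)%N -> (residue_count k j)%:R = coefs (G j) k.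
Proof.
elim: k j => [|k IH] j jn.
  (* As [D] has constant term 1, dividing by it keeps the constant coefficient of [S j]. *)
  have /(congr1 (fun f => coefs f 0%N)) : G j * D%:S = (S j)%:S.
    by rewrite divrK // denominator_unit.
  rewrite /= big_ord1 denominator_coef0 mulr1 => ->.
  rewrite /residue_count weight_count0 /S coefXnM sub0r rpredN.
  case: j jn => [|j] jn.
    by rewrite subn0 /W -(prednK n_gt0) lucas_rev_coef0 dvdz0.
  suff /negbTE -> : ~~ ((2 * n)%N %| j.+1%:Z)%Z by [].
  by rewrite dvdzE /=; apply/negP => /(dvdn_leq (ltn0Sn _)); lia.
rewrite residue_countS natrD.
have [->|j0] := posnP j.
  rewrite sub0r residue_countN add0r gf0E coef_fpsD coef_fps1 add0r.
  by rewrite coef_fpsXM coef_fpsD -(IH 1%N).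
have [->|jn'] := eqVneq j n.
  rewrite gfnE coef_fpsXM coef_fpsD -(IH n.-1) ?leq_pred //; congr (_ + _).
    by congr (residue_count _ _)%:R; lia.
  (* By reflection and periodicity the residues n + 1 and n - 1 have the same count. *)
  rewrite -residue_countN -residue_countD2n; congr (residue_count _ _)%:R; lia.
rewrite gfE; last by lia.
rewrite coef_fpsXM coef_fpsD -!IH; [|lia|lia].
by congr (_ + _); congr (residue_count _ _)%:R; lia.
Qed.

Lemma poincare_seriesE : poincare_series R n = (lucas_rev 2%:R n.+1)%:S / D%:S.
Proof.
apply: fpsP => k.
(* Doubled form of the claim, from 2 W_(n+1) = D + W_n, to match twice the dimension. *)
have e : (lucas_rev 2%:R n.+1)%:S / D%:S + (lucas_rev 2%:R n.+1)%:S / D%:S = 1 + G 0%N.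
  rewrite -(divrr denominator_unit) -!mulrDl -!fps_of_polyD; congr (_%:S / _).
  rewrite /S subn0 expr0 mul1r denominatorE /W -mul_polyC.
  by rewrite -{1 2 3 5}(prednK n_gt0) lucas_revSS; ring.
have n2 : (2%:R : R) != 0 by rewrite pnatr_eq0.
apply: (mulfI n2); rewrite [RHS]mulr_natl [RHS]mulr2n.
rewrite -coef_fpsD e coef_fpsD coef_fps1.
rewrite -natrM -residue_gf //; case: k => [|k].
  (* The flip fixes the empty word, so at k = 0 the dimension is the full count 1; the summand 1 in
     1 + f_0 compensates. *)
  rewrite dim_dihedral_invariants0 /residue_count weight_count0 subr0 dvdz0.
  by rewrite muln1 mulr2n.
rewrite dim_dihedral_invariants // add0r; congr _%:R.
by apply: eq_weight_count => z; rewrite subr0.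
Qed.

End Walk.

Unset Implicit Arguments.

Theorem theorem3p31 (R : realType) (n : nat) (hn : (2 <= n)%N) :
  let denominator : {poly R} :=
    (1 - 4%:R *: 'X^2) *
      \prod_(1 <= r < n) (1 - (2%:R * cos (pi * r%:R / n%:R)) *: 'X) in
  [/\ poincare_series R n = (chebT_rev R n.+1)%:S / denominator%:S,
      (chebT_rev R n.+1)%:S / denominator%:S =
        (\prod_(1 <= r < n.+2)
           (1 - (2%:R * cos ((2 * r - 1)%:R * pi / (2 * n.+1)%:R)) *: 'X))%:S
        / denominator%:S
    & (\prod_(1 <= r < n.+2)
         (1 - (2%:R * cos ((2 * r - 1)%:R * pi / (2 * n.+1)%:R)) *: 'X))%:S
        / denominator%:S =
        (2%:R ^- n *: \sum_(0 <= r < (n.+1)./2.+1)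
           'C(n.+1, 2 * r)%:R *: (1 - 4%:R *: 'X^2) ^+ r)%:S
        / ((1 - 4%:R *: 'X^2) *
             \sum_(0 <= r < (n.-1)./2.+1)
               ((-1) ^+ r * 'C(n - 1 - r, r)%:R) *: 'X^(2 * r))%:S ].
Proof.
have n0 : (0 < n)%N by apply: ltn_trans hn.
move=> denominator.
have dE : denominator = (1 - 4%:R *: 'X^2) * lucas_rev 1 n.-1.
  by rewrite /denominator -lucas_rev1_prod.
rewrite dE chebT_rev_lucas -lucas_rev2_prod.
split=> //; first exact: poincare_seriesE.
congr (_%:S / (_ * _)%:S).
- have n2 : (2%:R : R) ^+ n.+1 != 0 by rewrite expf_neq0 // pnatr_eq0.
  (* The expansion is taken with n + 2 terms and then cut where 2r exceeds n + 1; its factor 2 turns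
     2^(n+1) into 2^n. *)
  apply: (scalerI n2); rewrite (@lucas_rev2_sum _ _ n.+2) // scalerA (exprS _ n).
  rewrite mulfK ?expf_neq0 ?pnatr_eq0 //; congr (_ *: _).
  rewrite (@big_cat_nat _ _ _ (n.+1)./2.+1) //=; last by rewrite !ltnS; lia.
  rewrite [X in _ + X]big_nat_cond [X in _ + X]big1 ?addr0 // => r /andP[/andP[r1 r2] _].
  by rewrite bin_small ?scale0r //; lia.
(* Likewise n terms are cut where 2r exceeds n - 1. *)
- rewrite (@lucas_rev1_sum _ _ n) ?prednK // subn1.
  rewrite (@big_cat_nat _ _ _ (n.-1)./2.+1) //=; last by lia.
  rewrite [X in _ + X]big_nat_cond [X in _ + X]big1 ?addr0 // => r /andP[/andP[r1 r2] _].
  by rewrite bin_small ?mulr0 ?scale0r //; lia.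
Qed.
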